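(* Let $1<p<\infty$, let $w\in A_p^{\mathcal{D}}$ be a weight on $\mathbb{R}^n$, and let $\mathcal{S}\subset\mathcal{D}$ be a sparse collection with Carleson constant $\Lambda>1$ and with no infinitely increasing chains. Then the function $$b_{\mathcal{S}}^w:=\sum_{Q\in\mathcal{S}}\langle w\rangle_Q\mathbf{1}_Q$$ belongs to $BMO^{\mathcal{D}}(w)$, with $$\|b_{\mathcal{S}}^w\|_{BMO^{\mathcal{D}}(w)}\le 2[w]_{A_p}\Lambda^p .$$
   Context: $\mathcal{D}$ is a fixed dyadic grid on $\mathbb{R}^n$: a collection of cubes with side lengths $2^k$, $k\in\mathbb{Z}$, such that for each fixed $k$ the cubes of side length $2^k$ partition $\mathbb{R}^n$, and $P\cap Q\in\{P,Q,\emptyset\}$ for all $P,Q\in\mathcal{D}$. A collection $\mathcal{S}\subset\mathcal{D}$ has Carleson constant $\Lambda>1$ (is $\Lambda$-Carleson) if $\sum_{P\in\mathcal{S},P\subset Q}|P|\le\Lambda|Q|$ for all $Q\in\mathcal{D}$; it is sparse if it is $\Lambda$-Carleson for some $\Lambda>1$ (equivalently, for some $\eta\in(0,1)$ there are pairwise disjoint measurable sets $E_Q\subset Q$, $Q\in\mathcal{S}$, with $|E_Q|\ge\eta|Q|$; one may take $\eta=1/\Lambda$). $\mathcal{S}$ has an infinitely increasing chain if there are $Q_k\in\mathcal{S}$, $k\in\mathbb{N}$, with $Q_k\subsetneq Q_{k+1}$ for all $k$. A weight is a locally integrable, a.e. positive function $w$; $w(Q)=\int_Q w\,dx$ and $\langle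 f\rangle_Q=\frac1{|Q|}\int_Q f\,dx$. With $1/p+1/p'=1$ and $w'=w^{1-p'}$, $w\in A_p^{\mathcal{D}}$ means $[w]_{A_p}:=\sup_{Q\in\mathcal{D}}\langle w\rangle_Q\langle w'\rangle_Q^{p-1}<\infty$. For locally integrable $b$, $\|b\|_{BMO^{\mathcal{D}}(w)}=\sup_{Q\in\mathcal{D}}\frac1{w(Q)}\int_Q|b-\langle b\rangle_Q|\,dx$. *)

(* Defs.v *)
From HB Require Import structures.
From mathcomp Require Import all_boot all_order all_algebra.
From mathcomp Require Import all_classical all_reals all_analysis measurable_realfun.
Set Implicit Arguments.
Unset Strict Implicit.
Unset Printing Implicit Defensive.
Import Order.TTheory GRing.Theory Num.Theory.
Import numFieldNormedType.Exports.
Local Open Scope classical_set_scope.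
Local Open Scope ring_scope.
Local Open Scope ereal_scope.

Section cons_measure.
Context {d : measure_display} {T : measurableType d} {R : realType} {n : nat}.
Variable mu : {sigma_finite_measure set T -> \bar R}.
Variable nu : {sigma_finite_measure set (n.-tuple T) -> \bar R}.

Definition tuple_cons (x : T * n.-tuple T) : n.+1.-tuple T :=
  [tuple of x.1 :: x.2].

(* the product of mu and nu, transported to tuples *)
Definition cons_measure : set (n.+1.-tuple T) -> \bar R :=
  pushforward (mu \x nu) tuple_cons.

Lemma measurable_tuple_cons : measurable_fun setT tuple_cons.
Proof. exact: measurable_cons measurable_fst measurable_snd. Qed.

Let cons_measure0 : cons_measure set0 = 0.
Proof. by rewrite /cons_measure /pushforward preimage_set0 measure0. Qed.

Let cons_measure_ge0 A : 0 <= cons_measure A.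
Proof. by rewrite /cons_measure /pushforward. Qed.

Let cons_measure_sigma_additive : semi_sigma_additive cons_measure.
Proof.
move=> F mF tF mUF; rewrite /cons_measure /pushforward preimage_bigcup.
have mT X : measurable X -> measurable (tuple_cons @^-1` X).
  by move=> mX; rewrite -[X in measurable X]setTI; exact: measurable_tuple_cons.
apply: measure_semi_sigma_additive.
- by move=> i; exact: mT.
- apply/trivIsetP => i j _ _ ij; rewrite -preimage_setI.
  by move/trivIsetP : tF => /(_ i j Logic.I Logic.I ij) ->; rewrite preimage_set0.
- by rewrite -preimage_bigcup; exact: mT.
Qed.

HB.instance Definition _ := isMeasure.Build _ _ _ cons_measure
  cons_measure0 cons_measure_ge0 cons_measure_sigma_additive.

Let cons_measure_sigma_finite : sigma_finite setT cons_measure.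
Proof.
have /sigma_finiteP[F [TF ndF Foo]] := sigma_finiteT mu.
have /sigma_finiteP[G [TG ndG Goo]] := sigma_finiteT nu.
pose h (t : n.+1.-tuple T) : T * n.-tuple T :=
  (tnth t ord0, [tuple of behead t]).
have mh : measurable_fun setT h.
  apply/measurable_fun_pair => /=; first exact: measurable_tnth.
  exact: measurable_behead.
have hK : cancel tuple_cons h.
  by case=> x t; rewrite /h /tuple_cons /=; congr pair; apply/val_inj.
exists (fun i => h @^-1` (F i `*` G i)).
  apply/seteqP; split=> // t _.
  have [i _ Fi] : (\bigcup_i F i) (h t).1 by rewrite -TF.
  have [j _ Gj] : (\bigcup_i G i) (h t).2 by rewrite -TG.
  exists (maxn i j) => //; split.
  - by move: Fi; exact/subsetPset/ndF/leq_maxl.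
  - by move: Gj; exact/subsetPset/ndG/leq_maxr.
move=> i; have [mFi Fi] := Foo i; have [mGi Gi] := Goo i; split.
  by rewrite -[X in measurable X]setTI; apply: mh => //; exact: measurableX.
rewrite /cons_measure /pushforward -comp_preimage.
rewrite (_ : h \o _ = id) ?preimage_id; last by apply/funext => x /=; rewrite hK.
by rewrite product_measure1E// lte_mul_pinfty// ge0_fin_numE.
Qed.

HB.instance Definition _ := Measure_isSigmaFinite.Build _ _ _ cons_measure
  cons_measure_sigma_finite.

End cons_measure.

(* the n-fold product of the Lebesgue measure of R, on the Borel sets *)
Fixpoint borel_lebesgue (R : realType) (n : nat) :
    {sigma_finite_measure set (n.-tuple (measurableTypeR R)) -> \bar R} :=
  match n with
  | 0 => \d_([tuple] : 0.-tuple (measurableTypeR R))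
  | m.+1 => cons_measure lebesgue_measure (borel_lebesgue R m)
  end.

Lemma borel_lebesgue_box (R : realType) (n : nat) (A : 'I_n -> set (measurableTypeR R)) :
  (forall i, measurable (A i)) ->
  measurable [set x : n.-tuple (measurableTypeR R) | forall i, A i (tnth x i)] /\
  borel_lebesgue R n [set x | forall i, A i (tnth x i)] = 
   \prod_(i < n) lebesgue_measure (A i).
Proof.
elim: n A => [|n IH] A mA.
  rewrite (_ : [set x | _] = setT); last by apply/seteqP; split=> // x _ [].
  by split=> //; rewrite big_ord0 /= diracT.
have [mB IHB] := IH (fun i => A (lift ord0 i)) (fun i => mA _).
have key (x : n.+1.-tuple R) i : tnth [tuple of behead x] i = tnth x (lift ord0 i).
  by rewrite !(tnth_nth 0%R) /= nth_behead.
set C := [set x | _].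
have -> : C = (fun t : n.+1.-tuple _ => tnth t ord0) @^-1` A ord0 `&`
   (fun x : n.+1.-tuple _ => [tuple of behead x]) @^-1` [set x | forall i, A (lift ord0 i) (tnth x i)].
  apply/seteqP; split=> [x /= h|x /= [h0 h] i].
    by split=> // i; rewrite key.
  have [j ->|->//] := unliftP ord0 i.
  by rewrite -key.
split.
  apply: measurableI.
    by rewrite -[X in measurable X]setTI; apply: measurable_tnth => //; exact: mA.
  by rewrite -[X in measurable X]setTI; apply: measurable_behead => //.
rewrite big_ord_recl -IHB -product_measure1E//=.
rewrite /cons_measure /pushforward; congr (_ _).
apply/seteqP; split=> [[x t] /= [h0 h]|[x t] /= [h0 h]]; split => // i; move: (h i);
  by rewrite /= !(tnth_nth 0%R).
Qed.

(* R^n with its Lebesgue measurable sets: caratheodory_type completes the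
   Borel sigma-algebra *)
Definition Rn (R : realType) (n : nat) : Type :=
  caratheodory_type ((borel_lebesgue R n)^*)%mu.
HB.instance Definition _ (R : realType) (n : nat) := Measurable.on (Rn R n).

Definition lebesgue_Rn (R : realType) (n : nat) :
    {measure set (Rn R n) -> \bar R} :=
  @completed_measure_extension _ _ _ (borel_lebesgue R n).

Lemma lebesgue_Rn_box (R : realType) (n : nat) (A : 'I_n -> set (measurableTypeR R)) :
  (forall i, measurable (A i)) ->
  measurable [set x : Rn R n | forall i, A i (tnth (x : n.-tuple R) i)] /\
  lebesgue_Rn R n [set x | forall i, A i (tnth (x : n.-tuple R) i)] = 
   \prod_(i < n) lebesgue_measure (A i).
Proof.
move=> mA; have [mB <-] := borel_lebesgue_box mA; split.
  by apply: sub_caratheodory; apply: sub_sigma_algebra.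
exact: measurable_mu_extE.
Qed.

Section dyadic.
Context {R : realType} {n : nat}.
Local Notation mu := (lebesgue_Rn R n).
Implicit Types (P Q K : set (Rn R n)) (D S : set (set (Rn R n))).
Implicit Types (w : Rn R n -> R) (f b : Rn R n -> \bar R).

Definition Rn_coord (x : Rn R n) : 'I_n -> R := tnth (x : n.-tuple R).

(* Cubes are half-open in every usual grid; here each endpoint of each side may
   be included (bl i = true, br i = false) or not. *)
Definition cube_of_side (l : R) Q : Prop :=
  exists (a : 'I_n -> R) (bl br : 'I_n -> bool), Q =
    [set x | forall i, Rn_coord x i \in
       Interval (BSide (bl i) (a i)) (BSide (br i) (a i + l)%R)].

Definition dyadic_grid D : Prop :=
  [/\ (forall Q, D Q -> exists k : int, cube_of_side (2 ^ k)%R Q),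
      (forall k : int,
         partition (D `&` cube_of_side (2 ^ k)%R) id [set: Rn R n]) &
      (forall P Q, D P -> D Q ->
         [\/ P `&` Q = P, P `&` Q = Q | P `&` Q = set0])].

Definition carleson D S (Lambda : R) : Prop :=
  forall Q, D Q ->
    \esum_(P in S `&` [set P | P `<=` Q]) mu P <= Lambda%:E * mu Q.

Definition infinitely_increasing_chain S : Prop :=
  exists F : nat -> set (Rn R n),
    (forall k, S (F k)) /\ (forall k, F k `<` F k.+1).

(* transports points to 'rV[R]_n, which carries the topology of R^n *)
Definition Rn_row (x : Rn R n) : 'rV[R]_n := (\row_i Rn_coord x i)%R.

Definition locally_integrable_Rn f : Prop :=
  measurable_fun setT f /\
  forall K, compact (Rn_row @` K) -> \int[mu]_(x in K) `|f x| < +oo.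

Definition weight w : Prop :=
  locally_integrable_Rn (EFin \o w) /\ {ae mu, forall x, (0 < w x)%R}.

Definition average f Q : \bar R := (\int[mu]_(x in Q) f x) / mu Q.

(* the solution of 1/p + 1/p' = 1 *)
Definition conjugate_exponent (p : R) : R := ((1 - p^-1)^-1)%R.

Definition dual_weight (p : R) w (x : Rn R n) : R :=
  (w x `^ (1 - conjugate_exponent p))%R.

Definition Ap_constant D (p : R) w : \bar R :=
  ereal_sup [set average (EFin \o w) Q *
                 average (EFin \o dual_weight p w) Q `^ (p - 1) | Q in D].

Definition Ap_weight D (p : R) w : Prop :=
  weight w /\ Ap_constant D p w < +oo.

Definition BMO_norm D w b : \bar R :=
  ereal_sup [set (\int[mu]_(x in Q) `|b x - average b Q|) /
                 (\int[mu]_(x in Q) (w x)%:E) | Q in D].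

Definition BMO D w b : Prop := locally_integrable_Rn b /\ BMO_norm D w b < +oo.

(* \bar R-valued because the sum may be +oo on a null set *)
Definition b_sparse S w (x : Rn R n) : \bar R :=
  \esum_(Q in S) (average (EFin \o w) Q * (\1_Q x)%:E).

End dyadic.

(* Main.v *)
Require Import Defs.
From mathcomp Require Import all_boot all_order all_algebra.
From mathcomp Require Import all_classical all_reals all_analysis.
From mathcomp Require Import measurable_realfun finmap.
From mathcomp Require Import ring lra.
Import Order.TTheory GRing.Theory Num.Theory.
Import numFieldNormedType.Exports.
Set Implicit Arguments.
Unset Strict Implicit.
Unset Printing Implicit Defensive.
Local Open Scope classical_set_scope.
Local Open Scope ring_scope.
Local Open Scope ereal_scope.

(** The grid is nested, so on a cube Q0 of the grid the function b splits as
    b = c + g: the cubes of S strictly containing Q0 contribute a constant c, and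
    the cubes of S inside Q0 contribute g = sum of <w>_P 1_P. Cubes of S above Q0
    that all lie in one cube are finitely many by the Carleson condition, since
    each has measure at least |Q0|; hence infinitely many of them would form an
    infinitely increasing chain, and so c is finite ([finite_ancestors]). The
    mean oscillation of b on Q0 is that of g, which is at most twice the integral
    of g ([mean_oscillation_le]), and that integral is the sum of w(P) over the
    cubes P of S inside Q0. What has to be shown is therefore the Carleson
    embedding
      sum of w(P) over P in S, P included in Q0  <=  [w]_Ap Lambda^p w(Q0)
    ([dyadic_carleson_embedding]).

    In place of disjoint sets E_P included in P with |E_P| >= |P| / Lambda, the
    embedding uses densities: functions phi_P with 0 <= phi_P <= 1_P, of integral
    |P| / Lambda and with sum Psi <= 1. For finitely many cubes they are built by
    adding the cubes in an order in which each new cube is maximal, and taking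
    for phi_P a constant fraction of what the smaller cubes left free in P; the
    Carleson condition says exactly that enough is left ([packing_density]).
    Hoelder's inequality for phi w^(1/p) and w^(-1/p), together with the Ap
    condition, gives w(P) <= [w]_Ap Lambda^p times the integral of phi_P w
    ([Ap_test]), and summing over P replaces the right-hand side by the integral
    of Psi w, which is at most w(Q0).

    Local integrability of b follows because a bounded set meets only finitely
    many unit cubes of the grid, on each of which b is integrable. *)

(** * Densities of a finite packed family *)

Lemma exists_maximal_set (T : Type) (s : seq (set T)) : s != [::] ->
  exists2 Q, Q \in s & forall P, P \in s -> Q `<=` P -> P = Q.
Proof.
elim: s => // a [|b s] IH _.
  exists a; first exact: mem_head.
  by move=> P; rewrite inE => /eqP.
have [//|Q Qs Qmax] := IH _.
have [Qa|nQa] := pselect (Q `<=` a).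
  exists a => [|P]; first exact: mem_head.
  rewrite inE => /orP[/eqP //|Ps aP].
  have PQ := Qmax _ Ps (subset_trans Qa aP).
  by apply/seteqP; split=> //; rewrite PQ.
exists Q => [|P]; first by rewrite inE Qs orbT.
by rewrite inE => /orP[/eqP -> //|]; exact: Qmax.
Qed.

Section packing.
Context d (T : measurableType d) (R : realType) (mu : {measure set T -> \bar R}).

Lemma integral_mul_indic (A Q : set T) (f : T -> \bar R) :
  \int[mu]_(x in A) (f x * (\1_Q x)%:E) = \int[mu]_(x in A `&` Q) f x.
Proof.
rewrite integral_mkcondr; apply: eq_integral => x _.
by rewrite epatch_indic.
Qed.

(** The function [Psi] accumulates the densities of the sets of [s]; only their
    sum is recorded. The last clause of the conclusion, which bounds the mass
    already spent inside a set [A] that cuts no set of [s], is what makes the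
    induction go through: applied to the next set it shows that a fraction at
    least [Lambda^-1] of its measure is still free. The hypothesis on [C] says
    that a density carrying at least the mass [mu Q / Lambda] on [Q] controls the
    weight of [Q] up to the factor [C]. *)
Lemma packing_density (w : T -> R) (Q0 : set T) (Lambda C : R)
    (s : seq (set T)) :
  measurable_fun setT w -> (forall x, (0 <= w x)%R) -> measurable Q0 ->
  (0 < Lambda)%R -> (0 <= C)%R -> uniq s ->
  (forall Q, Q \in s ->
     [/\ measurable Q, 0 < mu Q, mu Q < +oo & Q `<=` Q0]) ->
  (forall P Q, P \in s -> Q \in s ->
     [\/ P `<=` Q, Q `<=` P | P `&` Q = set0]) ->
  (forall Q, Q \in s ->
     \sum_(P <- s | `[< P `<=` Q >]) mu P <= Lambda%:E * mu Q) ->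
  (forall Q (phi : T -> R), Q \in s -> measurable_fun setT phi ->
     (forall x, (0 <= phi x <= 1)%R) ->
     mu Q <= Lambda%:E * \int[mu]_(x in Q) (phi x)%:E ->
     \int[mu]_(x in Q) (w x)%:E <=
       C%:E * \int[mu]_(x in Q) (phi x * w x)%:E) ->
  exists Psi : T -> R, [/\ measurable_fun setT Psi,
    forall x, (0 <= Psi x <= 1)%R,
    \sum_(P <- s) \int[mu]_(x in P) (w x)%:E <=
      C%:E * \int[mu]_(x in Q0) (Psi x * w x)%:E &
    forall A, measurable A ->
      (forall P, P \in s -> P `<=` A \/ P `&` A = set0) ->
      Lambda%:E * \int[mu]_(x in A) (Psi x)%:E <=
        \sum_(P <- s | `[< P `<=` A >]) mu P].
Proof.
move=> mw w0 mQ0 L0 C0; move: {2}(size s) (erefl (size s)) => k.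
elim: k s => [|k IH] s.
  move=> /size0nil -> _ _ _ _ _; exists (cst 0%R); split => //.
  - by move=> x; rewrite lexx ler01.
  - rewrite big_nil mule_ge0 ?lee_fin//; apply: integral_ge0 => x _.
    by rewrite /= mul0r.
  - by move=> A mA _; rewrite big_nil integral0 mule0.
move=> sk us sP nest pack test.
(* A maximal set is removed, so the others are inside it or disjoint from it. *)
have [|Q Qs Qmax] := @exists_maximal_set _ s.
  by rewrite -size_eq0 sk.
pose s' := rem Q s.
have ps : perm_eq s (Q :: s') := perm_to_rem Qs.
have mems' P : P \in s' = (P != Q) && (P \in s) by rewrite mem_rem_uniq // inE.
have subs' P : P \in s' -> P \in s by exact: mem_rem.
have ss' : size s' = k by rewrite size_rem// sk.
have us' : uniq s' by exact: rem_uniq.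
have [||||Psi' [mPsi' Psi'01 sumPsi' intPsi']] := IH s' ss' us'.
- by move=> P /subs'; exact: sP.
- by move=> P P' /subs' ? /subs' ?; exact: nest.
- move=> P /subs' sP'; apply: le_trans (pack _ sP').
  rewrite [leRHS](perm_big _ ps)/= big_cons; case: ifP => // _.
  by rewrite leeDr.
- by move=> P phi /subs'; exact: test.
have [mQ Q_gt0 Q_fin QQ0] := sP _ Qs.
have below P : P \in s' -> P `<=` Q \/ P `&` Q = set0.
  rewrite mems' => /andP[PnQ Ps].
  have [|QP|] := nest P Q Ps Qs; [by left| |by right].
  by move: PnQ; rewrite (Qmax _ Ps QP) eqxx.
have packQ : mu Q + Lambda%:E * \int[mu]_(x in Q) (Psi' x)%:E <= Lambda%:E * mu Q.
  apply: le_trans (pack _ Qs); rewrite [leRHS](perm_big _ ps)/= big_cons.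
  rewrite ifT; last by apply/asboolP.
  by rewrite leeD2l// intPsi'.
have mres : measurable_fun setT (fun x => (1 - Psi' x)%R).
  by apply: measurable_funB => //; exact: measurable_cst.
have res_ge0 x : (0 <= 1 - Psi' x)%R by rewrite subr_ge0; have /andP[] := Psi'01 x.
have Psi'_ge0 x : (0 <= Psi' x)%R by have /andP[] := Psi'01 x.
pose I := \int[mu]_(x in Q) (1 - Psi' x)%:E.
pose J := \int[mu]_(x in Q) (Psi' x)%:E.
have mE (f : T -> R) (A : set T) : measurable_fun setT f ->
    measurable_fun A (fun x => (f x)%:E).
  by move=> mf; apply/measurable_EFinP; exact: measurable_funTS.
have IJ : I + J = mu Q.
  rewrite /I /J -ge0_integralD//; last 4 first.
  - by move=> x _; rewrite lee_fin.
  - exact: mE.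
  - by move=> x _; rewrite lee_fin.
  - exact: mE.
  under eq_integral do rewrite -EFinD subrK.
  by rewrite integral_cst// mul1e.
have I_ge0 : 0 <= I by apply: integral_ge0 => x _; rewrite lee_fin.
have J_ge0 : 0 <= J by apply: integral_ge0 => x _; rewrite lee_fin.
have mQf : mu Q \is a fin_num by rewrite ge0_fin_numE.
have If : I \is a fin_num.
  by rewrite ge0_fin_numE// (le_lt_trans _ Q_fin)// -IJ leeDl.
have Jf : J \is a fin_num.
  by rewrite ge0_fin_numE// (le_lt_trans _ Q_fin)// -IJ leeDr.
rewrite -/J -(fineK mQf) -(fineK Jf) -!EFinM -EFinD lee_fin in packQ.
have IJR : (fine I + fine J = fine (mu Q))%R by rewrite -fineD// IJ.
have m_gt0 : (0 < fine (mu Q))%R by rewrite fine_gt0// Q_gt0.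
have LI : (fine (mu Q) <= Lambda * fine I)%R by move: packQ; rewrite -IJR; lra.
have LI_gt0 : (0 < Lambda * fine I)%R by exact: lt_le_trans LI.
(* The fraction t of the free part 1 - Psi' gives Q the mass mu Q / Lambda. *)
pose t : R := (fine (mu Q) / (Lambda * fine I))%R.
have t_ge0 : (0 <= t)%R by rewrite divr_ge0// ltW.
have t_le1 : (t <= 1)%R by rewrite ler_pdivrMr// mul1r.
pose phi x : R := (t * (1 - Psi' x))%R.
have mphi : measurable_fun setT phi by apply: measurable_funM.
have phi_ge0 x : (0 <= phi x)%R by rewrite mulr_ge0.
have phi_le x : (phi x <= 1 - Psi' x)%R by rewrite ler_piMl.
have intphi : Lambda%:E * \int[mu]_(x in Q) (phi x)%:E = mu Q.
  rewrite /phi; under eq_integral do rewrite EFinM.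
  rewrite ge0_integralZl_EFin//; last 2 first.
  - by move=> x _; rewrite lee_fin.
  - exact: mE.
  rewrite -/I -(fineK If) -!EFinM -[RHS]fineK// /t; congr EFin.
  have IN0 : fine I != 0%R by apply: contraTneq LI_gt0 => ->; rewrite mulr0 ltxx.
  by field; rewrite IN0 gt_eqF.
have m1Q : measurable_fun setT (\1_Q : T -> R) by exact: measurable_indic.
pose Psi x : R := (Psi' x + phi x * \1_Q x)%R.
have ind01 x : ((\1_Q x : R) = 0 \/ (\1_Q x : R) = 1)%R.
  by rewrite indicE; case: (x \in Q); [right|left].
have mPsi : measurable_fun setT Psi.
  by apply: measurable_funD => //; exact: measurable_funM.
have intsplit (A : set T) (g : T -> R) : measurable A -> measurable_fun setT g ->
    (forall x, (0 <= g x)%R) ->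
    \int[mu]_(x in A) (Psi x * g x)%:E = \int[mu]_(x in A) (Psi' x * g x)%:E
      + \int[mu]_(x in A `&` Q) (phi x * g x)%:E.
  move=> mA mg g0; rewrite -integral_mul_indic -ge0_integralD//; last 4 first.
  - by move=> x _; rewrite lee_fin mulr_ge0.
  - by apply: mE; exact: measurable_funM.
  - move=> x _; apply: mule_ge0; rewrite lee_fin; first exact: mulr_ge0.
    by rewrite indicE.
  - under eq_fun do rewrite -EFinM.
    by apply: mE; apply: measurable_funM => //; exact: measurable_funM.
  by apply: eq_integral => x _; rewrite -EFinM -EFinD /Psi; congr EFin; ring.
exists Psi; split => //.
- move=> x; rewrite /Psi; case: (ind01 x) => ->; rewrite ?mulr0 ?mulr1.
    by rewrite addr0.
  by rewrite addr_ge0//= -lerBrDl.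
- rewrite (perm_big _ ps)/= big_cons intsplit// (setIidr QQ0).
  rewrite ge0_muleDr; last 2 first.
  - by apply: integral_ge0 => x _; rewrite lee_fin mulr_ge0.
  - by apply: integral_ge0 => x _; rewrite lee_fin mulr_ge0.
  rewrite addeC leeD//; apply: test => //; last by rewrite intphi.
  by move=> x; rewrite phi_ge0 (le_trans (phi_le x))// gerBl.
- move=> A mA nA.
  have -> : \int[mu]_(x in A) (Psi x)%:E = \int[mu]_(x in A) (Psi' x)%:E
      + \int[mu]_(x in A `&` Q) (phi x)%:E.
    have := intsplit A (cst 1%R) mA (measurable_cst _) (fun=> ler01).
    under eq_integral do rewrite mulr1.
    under [X in _ = X + _]eq_integral do rewrite mulr1.
    by under [X in _ = _ + X]eq_integral do rewrite mulr1.
  rewrite ge0_muleDr; last 2 first.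
  - by apply: integral_ge0 => x _; rewrite lee_fin.
  - by apply: integral_ge0 => x _; rewrite lee_fin.
  rewrite [leRHS](perm_big _ ps)/= big_cons.
  have hA := intPsi' A mA (fun P sP' => nA P (subs' _ sP')).
  have [QA|QA0] := nA Q Qs.
    rewrite ifT; last by apply/asboolP.
    by rewrite (setIidr QA) intphi addeC leeD2l.
  rewrite setIC QA0 integral_set0 mule0 adde0.
  by case: ifP => // _; rewrite (le_trans hA)// leeDr.
Qed.

End packing.

(** * Ap weights and Hoelder's inequality *)

Section weights.
Context d (T : measurableType d) (R : realType) (mu : {measure set T -> \bar R}).

(** Hoelder's inequality for [phi * v^(1/p)] and [v^(-1/p)]: the exponent of [v]
    in the second factor becomes [- q / p = 1 - q], and [phi ^ p <= phi] since
    [phi <= 1]. *)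
Lemma hoelder_dual_weight (p : R) (v phi : T -> R) (Q : set T) : (1 < p)%R ->
  measurable_fun setT v -> (forall x, (0 < v x)%R) -> measurable Q ->
  measurable_fun setT phi -> (forall x, (0 <= phi x <= 1)%R) ->
  (\int[mu]_(x in Q) (phi x)%:E) `^ p <=
    (\int[mu]_(x in Q) (phi x * v x)%:E) *
    (\int[mu]_(x in Q) (v x `^ (1 - conjugate_exponent p))%:E) `^ (p - 1).
Proof.
move=> p1 mv v0 mQ mphi phi01.
have p0 : (0 < p)%R by lra.
have pN0 : (p != 0)%R by rewrite gt_eqF.
have p1N0 : (p - 1 != 0)%R by rewrite subr_eq0 gt_eqF.
pose q := conjugate_exponent p.
have qE : q = (p / (p - 1))%R.
  by rewrite /q /conjugate_exponent; field; rewrite p1N0 pN0.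
have q0 : (0 < q)%R by rewrite qE divr_gt0//; lra.
have pq : (p^-1 + q^-1 = 1)%R by rewrite qE invf_div; field.
have phi0 x : (0 <= phi x)%R by have /andP[] := phi01 x.
pose F x : R := (phi x * v x `^ p^-1 * \1_Q x)%R.
pose G x : R := (v x `^ (- p^-1) * \1_Q x)%R.
have m1 : measurable_fun setT (\1_Q : T -> R) by exact: measurable_indic.
have mvp r : measurable_fun setT (fun x => v x `^ r)%R.
  exact: (measurableT_comp (measurable_powR r)).
have mF : measurable_fun setT F.
  by do 2 (apply: measurable_funM => //).
have mG : measurable_fun setT G by apply: measurable_funM.
have := hoelder mu mF mG p0 q0 pq.
rewrite Lnorm1.
have -> : \int[mu]_x `|(EFin \o (F \* G)%R) x| = \int[mu]_(x in Q) (phi x)%:E.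
  rewrite [RHS]integral_mkcond; apply: eq_integral => x _.
  rewrite epatch_indic /= /F /G ger0_norm; last first.
    by rewrite !mulr_ge0// ?powR_ge0// indicE.
  rewrite -EFinM; congr EFin; rewrite indicE; case: (x \in Q); last by rewrite !mulr0.
  by rewrite !mulr1 powRN -mulrA mulfV ?mulr1// gt_eqF// powR_gt0.
move=> /(gt0_ler_poweR (ltW p0)) H.
apply: le_trans (H _ _) _.
- by rewrite in_itv/= leey andbT integral_ge0// => x _; rewrite lee_fin.
- by rewrite in_itv/= leey andbT mule_ge0// Lnorm_ge0.
rewrite poweRM ?Lnorm_ge0// poweR_Lnorm//.
have -> : 'N[mu]_q%:E[EFin \o G] `^ p =
    (\int[mu]_(x in Q) (v x `^ (1 - q))%:E) `^ (p - 1).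
  rewrite [X in _ `^ X = _](_ : p = q * (p - 1))%R; last by rewrite qE; field.
  have qN0 : q != 0%R by rewrite gt_eqF.
  rewrite poweRrM; congr (_ `^ _); rewrite (poweR_Lnorm _ _ qN0).
  rewrite [RHS]integral_mkcond; apply: eq_integral => x _.
  rewrite epatch_indic /= /G -EFinM; congr EFin.
  rewrite indicE; case: (x \in Q); last by rewrite !mulr0 normr0 powR0// gt_eqF.
  rewrite !mulr1 ger0_norm ?powR_ge0// -powRrM; congr (_ `^ _)%R.
  by rewrite qE; field; rewrite p1N0 pN0.
rewrite lee_wpmul2r ?poweR_ge0//.
rewrite [leRHS]integral_mkcond; apply: ge0_le_integral => //.
- by move=> x _; exact: poweR_ge0.
- under eq_fun do rewrite poweR_EFin.
  apply/measurable_EFinP; apply: (measurableT_comp (measurable_powR p)).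
  exact: measurableT_comp.
- apply/(measurable_restrictT _ mQ); apply/measurable_EFinP.
  by apply: measurable_funTS; exact: measurable_funM.
move=> x _; rewrite epatch_indic /= /F -EFinM lee_fin.
rewrite indicE; case: (x \in Q); last by rewrite !mulr0 normr0 powR0.
rewrite !mulr1 ger0_norm ?mulr_ge0 ?powR_ge0// powRM ?powR_ge0//.
rewrite -powRrM mulVf// powRr1; last exact: ltW.
rewrite ler_wpM2r//; first exact: ltW.
have [->|phiN0] := eqVneq (phi x) 0%R; first by rewrite powR0.
apply: ge1r_powR; last exact: ltW.
by have /andP[_ ->] := phi01 x; rewrite lt0r phiN0 phi0.
Qed.

(** With W and V the integrals of the weight and of the dual weight, m = mu Q, a
    the integral of phi and B that of phi v, one has
    W V^(p-1) <= A m^p <= A Lambda^p a^p <= A Lambda^p B V^(p-1), the last step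
    being [hoelder_dual_weight]; that same step and the bound on W V^(p-1) show
    that V^(p-1) is positive and finite, so that it cancels. *)
Lemma Ap_test (p : R) (v phi : T -> R) (Q : set T) (A Lambda : R) : (1 < p)%R ->
  measurable_fun setT v -> (forall x, (0 < v x)%R) -> measurable Q ->
  0 < mu Q -> mu Q < +oo -> (0 <= A)%R -> (0 < Lambda)%R ->
  \int[mu]_(x in Q) (v x)%:E *
    (\int[mu]_(x in Q) (v x `^ (1 - conjugate_exponent p))%:E) `^ (p - 1) <=
    A%:E * mu Q `^ p ->
  measurable_fun setT phi -> (forall x, (0 <= phi x <= 1)%R) ->
  mu Q <= Lambda%:E * \int[mu]_(x in Q) (phi x)%:E ->
  \int[mu]_(x in Q) (v x)%:E <=
    (A * Lambda `^ p)%:E * \int[mu]_(x in Q) (phi x * v x)%:E.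
Proof.
move=> p1 mv v0 mQ Q0 Qoo A0 L0 hA mphi phi01 hphi.
have p0 : (0 < p)%R by lra.
have phi0 x : (0 <= phi x)%R by have /andP[] := phi01 x.
have mE (f : T -> R) (D : set T) : measurable_fun setT f ->
    measurable_fun D (fun x => (f x)%:E).
  by move=> mf; apply/measurable_EFinP; exact: measurable_funTS.
have := hoelder_dual_weight p1 mv v0 mQ mphi phi01.
move: hA; set W := \int[mu]_(x in Q) (v x)%:E.
set V := \int[mu]_(x in Q) (v x `^ (1 - conjugate_exponent p))%:E.
set a := \int[mu]_(x in Q) (phi x)%:E.
set B := \int[mu]_(x in Q) (phi x * v x)%:E => hA hH.
have W0 : 0 <= W by apply: integral_ge0 => x _; rewrite lee_fin ltW.
have V0 : 0 <= V by apply: integral_ge0 => x _; rewrite lee_fin powR_ge0.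
have a0 : 0 <= a by apply: integral_ge0 => x _; rewrite lee_fin.
have B0 : 0 <= B by apply: integral_ge0 => x _; rewrite lee_fin mulr_ge0// ltW.
have BW : B <= W.
  apply: ge0_le_integral => //.
  - by move=> x _; rewrite lee_fin mulr_ge0// ltW.
  - by apply: mE; exact: measurable_funM.
  - exact: mE.
- move=> x _; rewrite lee_fin ler_piMl//; first exact: ltW.
    by have /andP[] := phi01 x.
have a_gt0 : 0 < a.
  rewrite lt0e a0 andbT; apply/eqP => a0'; move: hphi.
  by rewrite -/a a0' mule0 leNgt Q0.
have ap_gt0 : 0 < B * V `^ (p - 1) by rewrite (lt_le_trans _ hH)// poweR_gt0.
have B_gt0 : 0 < B.
  by rewrite lt0e B0 andbT; apply: contraTneq ap_gt0 => ->; rewrite mul0e ltxx.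
have W_gt0 : 0 < W := lt_le_trans B_gt0 BW.
have Vp_gt0 : 0 < V `^ (p - 1).
  rewrite lt0e poweR_ge0 andbT.
  by apply: contraTneq ap_gt0 => ->; rewrite mule0 ltxx.
have Vp_fin : V `^ (p - 1) \is a fin_num.
  rewrite ge0_fin_numE ?poweR_ge0// ltNge leye_eq; apply/eqP => Voo.
  move: hA; rewrite Voo gt0_muley// leye_eq => /eqP.
  apply/eqP; rewrite -ltey lte_mul_pinfty// ?lee_fin//.
  by rewrite poweR_lty.
have key : W * V `^ (p - 1) <= (A * Lambda `^ p)%:E * B * V `^ (p - 1).
  apply: (le_trans hA).
  rewrite EFinM -!muleA lee_wpmul2l ?lee_fin//.
  apply: (@le_trans _ _ ((Lambda%:E * a) `^ p)).
    apply: (gt0_ler_poweR (ltW p0)); rewrite // in_itv/= leey andbT//.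
    by rewrite mule_ge0// lee_fin ltW.
  rewrite poweRM//; last by rewrite lee_fin ltW.
  rewrite poweR_EFin.
  by rewrite lee_wpmul2l// lee_fin powR_ge0.
by move: key; rewrite lee_pmul2r.
Qed.

End weights.

(** * Cubes and boxes *)

Lemma finite_set_of_esum (R : realType) (I : choiceType) (A : set I)
    (a : I -> \bar R) (e : R) : (0 < e)%R -> (forall i, A i -> e%:E <= a i) ->
  \esum_(i in A) a i < +oo -> finite_set A.
Proof.
move=> e0 ea; apply: contraPP => /infinite_set_fset infA; apply/negP.
rewrite -leNgt leye_eq; apply/eqP/eq_infty => r.
have [B BA Br] := infA (Num.truncn (r / e)).+1.
apply: esum_ge; exists [set` B]; first by split => //; exact: finite_fset.
rewrite fsbig_finite// set_fsetK.
apply: (@le_trans _ _ (\sum_(i <- B) e%:E)); last first.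
  by rewrite big_seq [leRHS]big_seq; apply: lee_sum => i iB; apply: ea; exact: BA.
rewrite sumEFin lee_fin big_const_seq iter_addr_0 count_predT -mulr_natr.
rewrite mulrC -ler_pdivrMr//.
by rewrite (le_trans (ltW (truncnS_gt _)))// ler_nat Br.
Qed.

(** The measures of the sets add up to at most the finite measure of [B]. *)
Lemma finite_disjoint_family d (T : measurableType d) (R : realType)
    (mu : {measure set T -> \bar R}) (F : set (set T)) (B : set T) (e : R) :
  (0 < e)%R -> trivIset F id -> measurable B -> mu B < +oo ->
  (forall Q, F Q -> [/\ measurable Q, e%:E <= mu Q & Q `<=` B]) ->
  finite_set F.
Proof.
move=> e0 tF mB Boo FP; apply: (@finite_set_of_esum R _ _ mu e) => //.
  by move=> Q /FP[].
apply: le_lt_trans Boo; apply: ge_ereal_sup => _ [X [finX XF] <-].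
rewrite -measure_fin_bigcup//=.
- apply: le_measure; [apply/mem_set|exact/mem_set|].
    by apply: fin_bigcup_measurable => // Q /XF /FP[].
  by apply: bigcup_sub => Q /XF /FP[].
- exact: sub_trivIset tF.
- by move=> Q /XF /FP[].
Qed.

Section cubes.
Context (R : realType) (n : nat).
Local Notation mu := (lebesgue_Rn R n).

Lemma cube_measure (l : R) (Q : set (Rn R n)) : (0 < l)%R -> cube_of_side l Q ->
  measurable Q /\ mu Q = (l ^+ n)%:E.
Proof.
move=> l0 [a [bl [br ->]]].
pose A i : set (measurableTypeR R) :=
  [set` Interval (BSide (bl i) (a i)) (BSide (br i) (a i + l)%R)].
have mA i : measurable (A i) by exact: measurable_itv.
have [mQ EQ] := lebesgue_Rn_box mA; split; first exact: mQ.
apply: (eq_trans EQ).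
under eq_bigr do rewrite lebesgue_measure_itv /=.
rewrite (eq_bigr (fun=> l%:E)); last first.
  move=> i _; rewrite ifT; first by rewrite -EFinB addrC addKr.
  by rewrite lte_fin ltrDl.
by rewrite prodEFin prodr_const card_ord.
Qed.

Definition box (a b : 'I_n -> R) : set (Rn R n) :=
  [set x | forall i, Rn_coord x i \in `[a i, b i]].

Lemma box_measure (a b : 'I_n -> R) :
  measurable (box a b) /\ mu (box a b) < +oo.
Proof.
pose A i : set (measurableTypeR R) := [set` `[a i, b i]].
have mA i : measurable (A i) by exact: measurable_itv.
have [mQ EQ] := lebesgue_Rn_box mA; split; first exact: mQ.
apply: (eq_ind_r (fun z => z < +oo) _ EQ).
under eq_bigr do rewrite lebesgue_measure_itv /=.
rewrite (eq_bigr (fun i => (if (a i < b i)%R then b i - a i else 0)%R%:E)).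
  by rewrite prodEFin ltry.
by move=> i _; rewrite lte_fin; case: ifP.
Qed.

Lemma compact_box (a b : 'I_n -> R) : compact (@Rn_row R n @` box a b).
Proof.
rewrite (_ : _ @` _ = [set v : 'rV[R]_n | forall i, `[a i, b i]%classic (v ord0 i)]).
  exact: (@rV_compact R n (fun i => `[a i, b i]%classic)
    (fun i => @segment_compact R (a i) (b i))).
apply/seteqP; split=> [_ [x xab <-] i /=|v vab]; first by rewrite /Rn_row mxE; exact: xab.
exists [tuple v ord0 i | i < n] => [i|].
  by rewrite /Rn_coord tnth_mktuple; exact: vab.
by apply/rowP => i; rewrite mxE /Rn_coord tnth_mktuple.
Qed.

(** The coordinates are continuous, so each one is bounded on [K]; the sum of the
    bounds serves for all coordinates at once and for every dimension, zero
    included. *)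
Lemma compact_sub_box (K : set (Rn R n)) : compact (@Rn_row R n @` K) ->
  exists M : R, K `<=` box (fun=> - M)%R (fun=> M).
Proof.
move=> cK.
have H (i : 'I_n) : exists M : R, forall x, K x -> (`|Rn_coord x i| <= M)%R.
  have : compact ((fun v : 'rV[R]_n => v ord0 i) @` (@Rn_row R n @` K)).
    apply: continuous_compact => //; apply: continuous_subspaceT.
    exact: coord_continuous.
  move=> /compact_bounded[M [Mr MP]]; exists (M + 1)%R => x Kx.
  apply: (MP (M + 1)%R); first by rewrite ltrDl.
  by exists (Rn_row x); [exists x|rewrite mxE].
have [M MP] := choice H.
exists (\sum_i `|M i|)%R => x Kx i.
rewrite in_itv/= -ler_norml (le_trans (MP i x Kx))// (le_trans (ler_norm _))//.
by rewrite (bigD1 i)//= lerDl sumr_ge0.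
Qed.

Lemma cube_sub_box (l M : R) (Q : set (Rn R n)) : (0 < l)%R -> cube_of_side l Q ->
  Q `&` box (fun=> - M)%R (fun=> M) !=set0 ->
  Q `<=` box (fun=> - (M + l))%R (fun=> M + l)%R.
Proof.
move=> l0 [a [bl [br ->]]] [x [/= xQ xM]] y /= yQ i.
have := xQ i; have := xM i; have := yQ i; rewrite !in_itv/=.
move=> /andP[/lteifW y1 /lteifW y2] /andP[x3 x4] /andP[/lteifW x1 /lteifW x2].
by apply/andP; split; lra.
Qed.

Lemma cube_bounded (l : R) (Q : set (Rn R n)) : cube_of_side l Q ->
  exists a b, Q `<=` box a b.
Proof.
move=> [a [bl [br ->]]]; exists a, (fun i => a i + l)%R => x /= xQ i.
have := xQ i; rewrite !in_itv/= => /andP[/lteifW -> /lteifW ->].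
by [].
Qed.

End cubes.

(** * Sums over countable sets, integrals and mean oscillation *)

(** A sum over a countable set is a series, by one enumeration that serves for all
    nonnegative summands; results on series apply through it. *)
Lemma esum_countable (R : realType) (I : choiceType) (A : set I) :
  countable A -> A !=set0 ->
  exists (h : nat -> I) (P : pred nat), (forall k, P k -> A (h k)) /\
    forall a : I -> \bar R, (forall i, A i -> 0 <= a i) ->
      \esum_(i in A) a i = \sum_(k <oo | P k) a (h k).
Proof.
move=> /countable_injP[e einj] [a0 Aa0].
pose h k := xget a0 [set i | A i /\ e i = k].
have hA k : A (h k) by rewrite /h; case: xgetP => // i _ [].
have he i : A i -> h (e i) = i.
  move=> Ai; rewrite /h; case: xgetP => [j _ [Aj eji]|/(_ i) []//].
  by apply: einj eji; exact/mem_set.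
exists h, (mem (e @` A)); split => // a aA.
rewrite -(esum_pred_image a h) => [|k _|]; last 2 first.
- exact: aA.
- move=> k1 k2 /set_mem /set_mem[i1 Ai1 <-] /set_mem /set_mem[i2 Ai2 <-].
  by rewrite !he// => ->.
congr (esum _ _); apply/seteqP; split=> [i Ai|_ [k _ <-]]; last exact: hA.
by exists (e i); [apply/mem_set; exists i|exact: he].
Qed.

Section integral_esum.
Context d (T : measurableType d) (R : realType) (mu : {measure set T -> \bar R}).
Context (I : choiceType) (A : set I) (D : set T) (f : I -> T -> \bar R).
Hypotheses (cA : countable A) (mD : measurable D).
Hypotheses (mf : forall i, A i -> measurable_fun D (f i)).
Hypotheses (f0 : forall i x, A i -> 0 <= f i x).

Lemma measurable_fun_esum : measurable_fun D (fun x => \esum_(i in A) f i x).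
Proof.
have [->|/set0P A0] := eqVneq A set0.
  by under eq_fun do rewrite esum_set0; exact: measurable_cst.
have [h [P [hA hE]]] := esum_countable R cA A0.
under eq_fun do (rewrite hE; last by move=> i; exact: f0).
apply: (ge0_emeasurable_sum (P := P)) => [k x _ Pk|k Pk].
- exact: f0 (hA _ Pk).
- exact: mf (hA _ Pk).
Qed.

Lemma ge0_integral_esum : \int[mu]_(x in D) (\esum_(i in A) f i x) =
  \esum_(i in A) \int[mu]_(x in D) f i x.
Proof.
have [->|/set0P A0] := eqVneq A set0.
  by under eq_integral do rewrite esum_set0; rewrite integral0 esum_set0.
have [h [P [hA hE]]] := esum_countable R cA A0.
rewrite hE; last by move=> i Ai; apply: integral_ge0 => x _; exact: f0.
under eq_integral => x _ do (rewrite hE; last by move=> i; exact: f0).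
under eq_integral do rewrite eseries_mkcond.
rewrite integral_nneseries//.
- rewrite [RHS]eseries_mkcond.
  apply: eq_eseriesr => k _.
  by case: (P k) => //; rewrite integral0.
- by move=> k; have [/hA|_] := boolP (P k); [exact: mf|exact: measurable_cst].
- by move=> k x _; have [/hA|_] := boolP (P k); [exact: f0|].
Qed.

End integral_esum.

(** The values of a weight on a null set affect none of its integrals, nor those
    of its powers, so it may be taken positive everywhere. *)
Lemma positive_representative d (T : measurableType d) (R : realType)
    (mu : {measure set T -> \bar R}) (w : T -> R) :
  measurable_fun setT w -> {ae mu, forall x, (0 < w x)%R} ->
  exists v : T -> R, [/\ measurable_fun setT v, forall x, (0 < v x)%R &
    forall (g : R -> R) A, measurable_fun setT g -> measurable A ->
      \int[mu]_(x in A) (g (w x))%:E = \int[mu]_(x in A) (g (v x))%:E].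
Proof.
move=> mw w0; pose v x : R := if (0 < w x)%R then w x else 1%R.
have mv : measurable_fun setT v.
  apply: measurable_fun_ifT => //.
  exact: measurable_fun_ltr.
exists v; split => // [x|g A mg mA]; first by rewrite /v; case: ifP.
have mE (u : T -> R) : measurable_fun setT u ->
    measurable_fun A (fun x => (g (u x))%:E).
  move=> mu'; apply/measurable_EFinP; apply: measurable_funTS.
  exact: measurableT_comp.
apply: ae_eq_integral => //; [exact: mE|exact: mE|].
by apply: filterS w0 => x wx _; rewrite /v wx.
Qed.

Lemma lee_div_of_le_mul (R : realType) (x y z : \bar R) :
  0 < y -> y < +oo -> x <= z * y -> x / y <= z.
Proof.
case: y => // r r0 _ xzr; rewrite lte_fin in r0.
by rewrite inver gt_eqF// lee_pdivrMr.
Qed.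

Section integral_complements.
Context d (T : measurableType d) (R : realType) (mu : {measure set T -> \bar R}).

(** The integral of a nonnegative function is a supremum over the simple functions
    below it, hence monotone on arbitrary sets, such as those of compact image over
    which local integrability is tested. *)
Lemma le_ge0_integral_subset (A B : set T) (f g : T -> \bar R) :
  (forall x, A x -> 0 <= f x) -> (forall x, B x -> 0 <= g x) ->
  (forall x, A x -> B x /\ f x <= g x) ->
  \int[mu]_(x in A) f x <= \int[mu]_(x in B) g x.
Proof.
move=> f0 g0 fg; rewrite ge0_integralE// ge0_integralE//.
apply: ge_ereal_sup => _ [h /= hf <-]; apply: ereal_sup_ubound; exists h => //= x.
apply: (le_trans (hf x)); rewrite /patch.
have [/set_mem Ax|xA] := boolP (x \in A).
  by have [Bx fgx] := fg _ Ax; rewrite mem_set.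
by case: ifP => // /set_mem Bx; exact: g0.
Qed.

(** The constant [c] does not affect the oscillation of [b], and the oscillation of [g >= 0]
    around its mean is at most the integral of [g] plus that of its mean. *)
Lemma mean_oscillation_le (Q : set T) (b g : T -> \bar R) (c : \bar R) :
  measurable Q -> 0 < mu Q -> mu Q < +oo -> c \is a fin_num ->
  measurable_fun Q g -> (forall x, 0 <= g x) -> \int[mu]_(x in Q) g x < +oo ->
  0 <= c -> (forall x, Q x -> b x = c + g x) ->
  \int[mu]_(x in Q) `|b x - (\int[mu]_(x in Q) b x) / mu Q| <=
    2%:E * \int[mu]_(x in Q) g x.
Proof.
move=> mQ Q0 Qoo cf mg g0 Goo c0 bE.
set G := \int[mu]_(x in Q) g x in Goo *.
have G0 : 0 <= G by apply: integral_ge0.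
have Gf : G \is a fin_num by rewrite ge0_fin_numE.
have mf : mu Q \is a fin_num by rewrite ge0_fin_numE.
have m0 : (0 < fine (mu Q))%R by rewrite fine_gt0// Q0.
have mN0 : mu Q != 0 by rewrite gt_eqF.
set ga := G / mu Q.
have gam : ga * mu Q = G by rewrite /ga -muleA mulVe// mule1.
have ga0 : 0 <= ga.
  by rewrite /ga -(fineK mf) inver gt_eqF// mule_ge0// lee_fin invr_ge0 ltW.
have gaf : ga \is a fin_num.
  by rewrite /ga -(fineK mf) inver gt_eqF// fin_numM.
have -> : (\int[mu]_(x in Q) b x) / mu Q = c + ga.
  rewrite (eq_integral (fun x => c + g x)); last by move=> x /set_mem /bE.
  rewrite ge0_integralD//.
  rewrite -/G integral_cst//= -gam -ge0_muleDl// -muleA divee// ?mule1//.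
apply: (@le_trans _ _ (\int[mu]_(x in Q) (g x + ga))); last first.
  rewrite ge0_integralD//.
  by rewrite integral_cst//= gam -/G -mule2n -mule_natl.
apply: le_ge0_integral_subset => //.
- by move=> x _; rewrite adde_ge0.
- move=> x Qx; split => //; rewrite bE// fin_num_oppeD//.
  rewrite addeACA subee// add0e (le_trans (lee_abs_sub _ _))//.
  by rewrite !gee0_abs.
Qed.

End integral_complements.

(** * The dyadic grid *)

Section dyadic_grid_theory.
Context (R : realType) (n : nat).
Local Notation mu := (lebesgue_Rn R n).
Variable D : set (set (Rn R n)).
Hypothesis gridD : dyadic_grid D.

Lemma dyadic_measure Q : D Q -> [/\ measurable Q, 0 < mu Q & mu Q < +oo].
Proof.
have [sideD _ _] := gridD => /sideD[k]; set l := (2 ^ k)%R => Ql.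
have l0 : (0 < l)%R by rewrite exprz_gt0.
have [mQ ->] := cube_measure l0 Ql; split => //; last exact: ltry.
by rewrite lte_fin exprn_gt0.
Qed.

Lemma dyadic_nonempty Q : D Q -> Q !=set0.
Proof.
move=> /dyadic_measure[_ Q0 _]; apply/set0P; apply: contraTneq Q0 => ->.
by rewrite measure0 ltxx.
Qed.

Lemma dyadic_nested P Q : D P -> D Q ->
  [\/ P `<=` Q, Q `<=` P | P `&` Q = set0].
Proof.
have [_ _ nest] := gridD => DP DQ; have [/setIidPl|/setIidPr|] := nest P Q DP DQ.
- by constructor 1.
- by constructor 2.
- by constructor 3.
Qed.

Definition level_cubes (k : int) (M : R) : set (set (Rn R n)) :=
  [set Q | [/\ D Q, cube_of_side (2 ^ k)%R Q &
               Q `&` box (fun=> - M)%R (fun=> M) !=set0]].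

(** These cubes are disjoint, of equal positive measure, and contained in a fixed
    larger box. *)
Lemma finite_level_cubes k M : finite_set (level_cubes k M).
Proof.
set l := (2 ^ k : R)%R; have l0 : (0 < l)%R by rewrite exprz_gt0.
have [mB Boo] := @box_measure R n (fun=> - (M + l))%R (fun=> M + l)%R.
have [_ partD _] := gridD; have [_ tD _] := partD k.
apply: (finite_disjoint_family (e := (l ^+ n)%R) _ _ mB Boo).
- by rewrite exprn_gt0.
- by apply: sub_trivIset tD => Q [].
- move=> Q [DQ Ql QM]; have [mQ EQ] := cube_measure l0 Ql.
  by split => //; [rewrite EQ|exact: cube_sub_box QM].
Qed.

Lemma level_cubes_cover k M x : box (fun=> - M)%R (fun=> M) x ->
  exists2 Q, level_cubes k M Q & Q x.
Proof.
move=> xM; have [_ partD _] := gridD; have [covD _ _] := partD k.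
have : [set: Rn R n] x by [].
by rewrite -covD => -[Q [DQ Qk] Qx]; exists Q => //; split => //; exists x.
Qed.

Lemma grid_nonempty : D !=set0.
Proof.
have x0 : Rn R n := [tuple 0%R | i < n].
have [|Q [DQ _ _] _] := @level_cubes_cover 0 (\sum_i `|Rn_coord x0 i|)%R x0;
  last by exists Q.
move=> i; rewrite in_itv/= -ler_norml.
by rewrite (bigD1 i)//= lerDl sumr_ge0.
Qed.

(** Every cube of the grid meets a box of integer size, so [finite_level_cubes]
    exhausts the grid by countably many finite sets. *)
Lemma countable_grid : countable D.
Proof.
apply: (@sub_countable _ _ _ (\bigcup_(k in [set: int]) \bigcup_(m in [set: nat])
  level_cubes k m%:R)).
  apply: subset_card_le => Q DQ; have [sideD _ _] := gridD.
  have [k Qk] := sideD _ DQ; exists k => //.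
  have [x Qx] := dyadic_nonempty DQ.
  exists (Num.truncn (\sum_i `|Rn_coord x i|)%R).+1 => //; split => //.
  exists x; split => // i; rewrite in_itv/= -ler_norml.
  apply: (le_trans _ (ltW (truncnS_gt _))).
  by rewrite (bigD1 i)//= lerDl sumr_ge0.
apply: bigcup_countable => // k _; apply: bigcup_countable => // m _.
exact/finite_set_countable/finite_level_cubes.
Qed.

(** The ancestors of [Q0] are totally ordered by inclusion. A largest one [Q] would
    contain all the others, and the Carleson condition in [Q] would make them
    finitely many, each having measure at least that of [Q0]. So if they are
    infinitely many, each is strictly contained in another, which yields a chain. *)
Lemma finite_ancestors (S : set (set (Rn R n))) (Lambda : R) Q0 :
  S `<=` D -> carleson D S Lambda -> ~ infinitely_increasing_chain S -> D Q0 ->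
  finite_set (S `&` [set P | ~ P `<=` Q0 /\ Q0 `<=` P]).
Proof.
move=> SD carl nochain DQ0; apply: contrapT => infA; apply: nochain.
set A := S `&` _ in infA.
have [mQ0 Q0_gt0 Q0_fin] := dyadic_measure DQ0.
have step Q : exists Q', A Q -> A Q' /\ Q `<` Q'.
  have [AQ|] := pselect (A Q); last by exists Q.
  apply: contrapT => noQ'; apply: infA.
  have AsubQ P : A P -> P `<=` Q.
    move=> AP; have [PQ//|QP|PQ0] := dyadic_nested (SD _ AP.1) (SD _ AQ.1).
      have [//|nPQ] := pselect (P `<=` Q); exfalso; apply: noQ'; exists P => _.
      by split => //; split.
    have [x Q0x] := dyadic_nonempty DQ0; exfalso.
    by have : (P `&` Q) x by [split; [exact: AP.2.2|exact: AQ.2.2]]; rewrite PQ0.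
  have DQ := SD _ AQ.1; have [_ _ Q_fin] := dyadic_measure DQ.
  apply: (@finite_set_of_esum R _ A mu (fine (mu Q0))).
  - by rewrite fine_gt0// Q0_gt0.
  - move=> P AP; rewrite fineK ?ge0_fin_numE//.
    have [mP _ _] := dyadic_measure (SD _ AP.1).
    by apply: le_measure; [exact/mem_set|exact/mem_set|exact: AP.2.2].
  - have L0 : Lambda%:E * mu Q < +oo.
      rewrite ltey; apply/eqP => e.
      have : Lambda%:E * mu Q \is a fin_num by rewrite fin_numM// ge0_fin_numE.
      by rewrite e.
    apply: le_lt_trans L0; apply: le_trans (carl _ DQ).
    apply: ge_ereal_sup => _ [X [finX XA] <-]; apply: esum_ge; exists X => //.
    by split => // P /XA AP; split; [exact: AP.1|exact: AsubQ].
have [f fP] := choice step.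
have [Q1 AQ1] : A !=set0.
  by apply/set0P/negP => /eqP A0; apply: infA; rewrite A0; exact: finite_set0.
have AF k : A (iter k f Q1) by elim: k => //= k /fP[].
by exists (fun k => iter k f Q1); split => k; [exact: (AF k).1|exact: (fP _ (AF k)).2].
Qed.

End dyadic_grid_theory.

(** * Ap weights on a grid and the sparse function *)

Section sparse.
Context (R : realType) (n : nat).
Local Notation mu := (lebesgue_Rn R n).
Variables (D : set (set (Rn R n))) (p : R) (w : Rn R n -> R).
Variables (S : set (set (Rn R n))) (Lambda : R).
Hypotheses (gridD : dyadic_grid D) (p_gt1 : (1 < p)%R) (w_Ap : Ap_weight D p w).
Hypotheses (S_sub_D : S `<=` D) (Lambda_gt1 : (1 < Lambda)%R).
Hypothesis (S_carleson : carleson D S Lambda).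

(** Positivity comes from Hoelder's inequality with [phi = 1]: a power of the
    measure of [Q] is at most the weight of [Q] times a power of its dual weight,
    so neither factor vanishes. *)
Lemma dyadic_weight_gt0 Q : D Q ->
  0 < \int[mu]_(x in Q) (w x)%:E /\ \int[mu]_(x in Q) (w x)%:E < +oo.
Proof.
move=> DQ; have [mQ Q0 Qoo] := dyadic_measure gridD DQ.
have [[[/measurable_EFinP mw wloc] w0] _] := w_Ap.
have [v [mv v0 vw]] := positive_representative mw w0.
have E : \int[mu]_(x in Q) (w x)%:E = \int[mu]_(x in Q) (v x)%:E.
  by apply: (vw id Q) => //; exact: measurable_id.
split.
  rewrite E lt0e integral_ge0 ?andbT => [|x _]; last by rewrite lee_fin ltW.
  have one01 (x : Rn R n) : (0 <= (cst 1 x : R) <= 1)%R by rewrite ler01 lexx.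
  have := hoelder_dual_weight mu p_gt1 mv v0 mQ (measurable_cst _) one01.
  under [X in _ <= X * _]eq_integral do rewrite mul1r.
  have -> : \int[mu]_(x in Q) (cst 1 x : R)%:E = mu Q.
    by rewrite -[RHS]mul1e -integral_cst.
  move=> H; apply/eqP => W0; move: H; rewrite W0 mul0e leNgt.
  by rewrite poweR_gt0.
have mwQ : measurable_fun Q (EFin \o w).
  by apply/measurable_EFinP; exact: measurable_funTS.
apply: (@le_lt_trans _ _ (\int[mu]_(x in Q) `|(w x)%:E|)).
  rewrite (le_trans (lee_abs _))//.
  exact: le_abse_integral.
have [sideD _ _] := gridD; have [k Qk] := sideD _ DQ.
have [a [c Qac]] := cube_bounded Qk.
apply: le_lt_trans (wloc _ (@compact_box R n a c)).
by apply: le_ge0_integral_subset => // x /Qac.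
Qed.

Lemma average_weightK Q : D Q ->
  average (EFin \o w) Q * mu Q = \int[mu]_(x in Q) (w x)%:E.
Proof.
move=> DQ; have [mQ Q0 Qoo] := dyadic_measure gridD DQ.
by rewrite /average -muleA mulVe ?mule1 ?gt_eqF// ge0_fin_numE.
Qed.

Lemma average_weight_ge0 Q : D Q ->
  0 <= average (EFin \o w) Q /\ average (EFin \o w) Q < +oo.
Proof.
move=> DQ; have [mQ Q0 Qoo] := dyadic_measure gridD DQ.
have [W0 Woo] := dyadic_weight_gt0 DQ.
have mf : mu Q \is a fin_num by rewrite ge0_fin_numE.
have m0 : (0 < fine (mu Q))%R by rewrite fine_gt0// Q0.
rewrite /average -(fineK mf) inver gt_eqF//; split.
  by rewrite mule_ge0 ?(ltW W0)// lee_fin invr_ge0 ltW.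
by rewrite lte_mul_pinfty ?(ltW W0) ?ltry// ge0_fin_numE ?(ltW W0).
Qed.

Lemma Ap_constant_fin Q : D Q -> Ap_constant D p w \is a fin_num /\
  0 <= Ap_constant D p w.
Proof.
move=> DQ.
have A0 : 0 <= Ap_constant D p w.
  apply: le_trans (ereal_sup_ubound _); last by exists Q.
  by rewrite mule_ge0 ?poweR_ge0//; exact: (average_weight_ge0 DQ).1.
by rewrite ge0_fin_numE//; split => //; have [] := w_Ap.
Qed.

Lemma dyadic_Ap_inequality Q : D Q ->
  \int[mu]_(x in Q) (w x)%:E *
    (\int[mu]_(x in Q) (dual_weight p w x)%:E) `^ (p - 1) <=
  Ap_constant D p w * mu Q `^ p.
Proof.
move=> DQ; have [mQ Q0 Qoo] := dyadic_measure gridD DQ.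
have mf : mu Q \is a fin_num by rewrite ge0_fin_numE.
have m0 : (0 < fine (mu Q))%R by rewrite fine_gt0// Q0.
have p1N0 : (p - 1 != 0)%R by rewrite subr_eq0 gt_eqF.
have : average (EFin \o w) Q * average (EFin \o dual_weight p w) Q `^ (p - 1) <=
  Ap_constant D p w by apply: ereal_sup_ubound; exists Q.
move=> /(lee_wpmul2r (poweR_ge0 (mu Q) p)); apply: le_trans.
have -> : mu Q `^ p = mu Q * mu Q `^ (p - 1).
  rewrite -{2}[mu Q]poweRe1// -poweRD; first by congr (_ `^ _); ring.
  by rewrite nneg_neq0_poweRD_def ?gt_eqF ?ler01 ?subr_ge0 ?ltW.
rewrite muleACA average_weightK// -poweRM//; last first.
  rewrite /average mule_ge0 ?inve_ge0//.
  by apply: integral_ge0 => x _; rewrite lee_fin powR_ge0.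
rewrite /average /= -muleA mulVe ?mule1 ?gt_eqF//.
Qed.

(** The sum is the supremum of its finite subsums, and [packing_density] applies to
    each of these with the constant given by [Ap_test]. *)
Lemma dyadic_carleson_embedding Q0 : D Q0 ->
  \esum_(P in S `&` [set P | P `<=` Q0]) \int[mu]_(x in P) (w x)%:E <=
  Ap_constant D p w * (Lambda `^ p)%:E * \int[mu]_(x in Q0) (w x)%:E.
Proof.
move=> DQ0; have [mQ0 _ _] := dyadic_measure gridD DQ0.
have [Af A0] := Ap_constant_fin DQ0.
have [[[/measurable_EFinP mw _] w0] _] := w_Ap.
have [v [mv v0 vw]] := positive_representative mw w0.
have wv Q : measurable Q -> \int[mu]_(x in Q) (w x)%:E = \int[mu]_(x in Q) (v x)%:E.
  by move=> mQ; apply: (vw id Q) => //; exact: measurable_id.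
have wv' Q : measurable Q -> \int[mu]_(x in Q) (dual_weight p w x)%:E =
    \int[mu]_(x in Q) (v x `^ (1 - conjugate_exponent p))%:E.
  move=> mQ.
  exact: (vw (fun y => y `^ (1 - conjugate_exponent p))%R Q (measurable_powR _) mQ).
set A := fine (Ap_constant D p w).
have A_ge0 : (0 <= A)%R by rewrite fine_ge0.
have L0 : (0 < Lambda)%R by rewrite (lt_trans ltr01).
apply: ge_ereal_sup => _ [X [finX XS] <-].
have XD P : X P -> D P by move=> /XS[/S_sub_D].
pose s : seq (set (Rn R n)) := fset_set X.
have sX P : (P \in s) = (P \in X) by rewrite /s in_fset_set.
have [|||||||Psi [mPsi Psi01 sumPsi _]] := @packing_density _ _ R mu v Q0 Lambda
    (A * Lambda `^ p)%R s mv _ mQ0 L0 _ _ _ _ _ _.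
- by move=> x; exact: ltW.
- by rewrite mulr_ge0 ?powR_ge0.
- exact: fset_uniq.
- move=> Q; rewrite sX => /set_mem XQ.
  by have [? ? ?] := dyadic_measure gridD (XD _ XQ); split => //; exact: (XS _ XQ).2.
- move=> P Q; rewrite !sX => /set_mem XP /set_mem XQ.
  exact: (dyadic_nested gridD (XD _ XP) (XD _ XQ)).
- move=> Q; rewrite sX => /set_mem XQ; apply: le_trans (S_carleson (XD _ XQ)).
  rewrite esum_mkcondr; apply: esum_ge; exists X; first by split => // P /XS[].
  rewrite fsbig_finite// big_mkcond; exact: lee_sum.
- move=> Q phi; rewrite sX => /set_mem XQ mphi phi01 hphi.
  have [mQ Q_gt0 Q_fin] := dyadic_measure gridD (XD _ XQ).
  apply: (Ap_test p_gt1 mv v0 mQ Q_gt0 Q_fin A_ge0 L0 _ mphi phi01 hphi).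
  rewrite -wv// -wv'// /A fineK//; exact: dyadic_Ap_inequality (XD _ XQ).
rewrite fsbig_finite//=.
have -> : \sum_(P <- fset_set X) \int[mu]_(x in P) (w x)%:E =
    \sum_(P <- s) \int[mu]_(x in P) (v x)%:E.
  rewrite /s big_seq [RHS]big_seq; apply: eq_bigr => P; rewrite sX => /set_mem XP.
  by rewrite wv//; have [] := dyadic_measure gridD (XD _ XP).
apply: (le_trans sumPsi).
rewrite EFinM /A fineK// lee_wpmul2l ?mule_ge0 ?lee_fin ?powR_ge0// wv//.
have Psi0 x : (0 <= Psi x)%R by have /andP[] := Psi01 x.
apply: le_ge0_integral_subset => x Q0x.
- by rewrite lee_fin mulr_ge0// ltW.
- by rewrite lee_fin ltW.
- split => //; rewrite lee_fin ler_piMl//; first exact: ltW.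
  by have /andP[] := Psi01 x.
Qed.

Hypothesis S_chain : ~ infinitely_increasing_chain S.

(** An ancestor is described by two inclusions because of the way [b_sparse] is
    split, first according to whether [P] is included in [Q0]. *)
Let ancestors Q0 := S `&` [set P | ~ P `<=` Q0 /\ Q0 `<=` P].

Definition ancestors_sum Q0 : \bar R :=
  \esum_(P in ancestors Q0) average (EFin \o w) P.

Definition b_local Q0 (x : Rn R n) : \bar R :=
  \esum_(P in S `&` [set P | P `<=` Q0]) (average (EFin \o w) P * (\1_P x)%:E).

Let term_ge0 P x : D P -> 0 <= average (EFin \o w) P * (\1_P x)%:E.
Proof.
by move=> DP; rewrite mule_ge0 ?(average_weight_ge0 DP).1// lee_fin indicE.
Qed.

Let measurable_term P (E : set (Rn R n)) : D P ->
  measurable_fun E (fun x => average (EFin \o w) P * (\1_P x)%:E).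
Proof.
move=> DP; have [mP _ _] := dyadic_measure gridD DP.
apply: measurable_funeM; apply/measurable_EFinP.
exact: measurable_funTS (measurable_indic mP).
Qed.

Lemma ancestors_sum_fin Q0 : D Q0 -> 0 <= ancestors_sum Q0 /\
  ancestors_sum Q0 \is a fin_num.
Proof.
move=> DQ0.
have avg0 P : ancestors Q0 P -> 0 <= average (EFin \o w) P.
  by move=> [/S_sub_D DP _]; exact: (average_weight_ge0 DP).1.
have s0 : 0 <= ancestors_sum Q0 by apply: esum_ge0 => P /avg0.
split => //; rewrite ge0_fin_numE//.
have fA := finite_ancestors gridD S_sub_D S_carleson S_chain DQ0.
rewrite /ancestors_sum esum_fset//; last by move=> P /set_mem /avg0.
rewrite fsbig_finite// big_seq; apply: lte_sum_pinfty => P.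
rewrite in_fset_set// => /set_mem[/S_sub_D DP _].
exact: (average_weight_ge0 DP).2.
Qed.

(** At a point of [Q0], a cube of [S] that is not included in [Q0] either contains
    [Q0], so that its indicator is 1, or is disjoint from [Q0]. *)
Lemma b_sparse_local Q0 x : D Q0 -> Q0 x ->
  b_sparse S w x = ancestors_sum Q0 + b_local Q0 x.
Proof.
move=> DQ0 Q0x; rewrite /b_sparse (esumID [set P | P `<=` Q0]); last first.
  by move=> P /S_sub_D; exact: term_ge0.
rewrite addeC; congr (_ + _); rewrite /ancestors_sum /ancestors.
rewrite esum_mkcondr [RHS]esum_mkcondr; apply: eq_esum => P SP.
have DP := S_sub_D SP.
have [PQ|QP|PQ0] := dyadic_nested gridD DP DQ0.
- rewrite memNset; last by move=> /(_ PQ).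
  by rewrite memNset// => -[/(_ PQ)].
- have [PQ|nPQ] := pselect (P `<=` Q0).
    rewrite memNset; last by move=> /(_ PQ).
    by rewrite memNset// => -[/(_ PQ)].
  rewrite mem_set// mem_set; last by split.
  by rewrite indicE mem_set ?mule1//; exact: QP.
- have nPx : ~ P x by move=> Px; have : (P `&` Q0) x by []; rewrite PQ0.
  rewrite indicE (memNset nPx) mule0; case: ifP => _; rewrite memNset// => -[_].
    by move=> /(_ _ Q0x).
  by move=> /(_ _ Q0x).
Qed.

Lemma measurable_b_sparse : measurable_fun setT (b_sparse S w).
Proof.
have cS : countable S.
  by apply: sub_countable (countable_grid gridD); exact: subset_card_le.
have mS P : S P -> measurable_fun setT
    (fun x => average (EFin \o w) P * (\1_P x)%:E).
  by move=> /S_sub_D; exact: measurable_term.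
have S0 P x : S P -> 0 <= average (EFin \o w) P * (\1_P x)%:E.
  by move=> /S_sub_D; exact: term_ge0.
exact: measurable_fun_esum cS mS S0.
Qed.

Lemma b_local_ge0 Q0 x : 0 <= b_local Q0 x.
Proof. by apply: esum_ge0 => P [/S_sub_D DP _]; exact: term_ge0. Qed.

Lemma countable_descendants Q0 : countable (S `&` [set P | P `<=` Q0]).
Proof.
apply: sub_countable (countable_grid gridD).
by apply: subset_card_le => P [/S_sub_D].
Qed.

Lemma measurable_b_local Q0 E : measurable_fun E (b_local Q0).
Proof.
set A := S `&` [set P | P `<=` Q0].
have mA P : A P -> measurable_fun E
    (fun x => average (EFin \o w) P * (\1_P x)%:E).
  by move=> [/S_sub_D DP _]; exact: measurable_term.
have A0 P x : A P -> 0 <= average (EFin \o w) P * (\1_P x)%:E.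
  by move=> [/S_sub_D DP _]; exact: term_ge0.
exact: measurable_fun_esum (countable_descendants Q0) mA A0.
Qed.

Lemma integral_b_local Q0 : D Q0 -> \int[mu]_(x in Q0) b_local Q0 x =
  \esum_(P in S `&` [set P | P `<=` Q0]) \int[mu]_(x in P) (w x)%:E.
Proof.
move=> DQ0; have [mQ0 _ _] := dyadic_measure gridD DQ0.
set A := S `&` [set P | P `<=` Q0].
have mA P : A P -> measurable_fun Q0
    (fun x => average (EFin \o w) P * (\1_P x)%:E).
  by move=> [/S_sub_D DP _]; exact: measurable_term.
have A0 P x : A P -> 0 <= average (EFin \o w) P * (\1_P x)%:E.
  by move=> [/S_sub_D DP _]; exact: term_ge0.
rewrite (ge0_integral_esum _ (countable_descendants Q0) mQ0 mA A0).
apply: eq_esum => P [/S_sub_D DP PQ0].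
have [mP _ _] := dyadic_measure gridD DP.
rewrite integral_mul_indic (setIidr PQ0) -average_weightK//.
exact: integral_cst.
Qed.

Lemma integral_b_local_le Q0 : D Q0 -> \int[mu]_(x in Q0) b_local Q0 x <=
  Ap_constant D p w * (Lambda `^ p)%:E * \int[mu]_(x in Q0) (w x)%:E.
Proof. by move=> DQ0; rewrite integral_b_local//; exact: dyadic_carleson_embedding. Qed.

Lemma integral_b_local_fin Q0 : D Q0 -> \int[mu]_(x in Q0) b_local Q0 x < +oo.
Proof.
move=> DQ0; apply: (le_lt_trans (integral_b_local_le DQ0)).
have [W0 Woo] := dyadic_weight_gt0 DQ0.
have [Af A0] := Ap_constant_fin DQ0.
have : Ap_constant D p w * (Lambda `^ p)%:E * \int[mu]_(x in Q0) (w x)%:E \is a fin_num.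
  by rewrite !fin_numM// ge0_fin_numE// ltW.
by rewrite fin_numE => /andP[_]; rewrite ltey.
Qed.

Lemma BMO_norm_b_sparse : BMO_norm D w (b_sparse S w) <=
  2%:E * Ap_constant D p w * (Lambda `^ p)%:E.
Proof.
apply: ge_ereal_sup => _ [Q DQ <-].
have [mQ Q0 Qoo] := dyadic_measure gridD DQ.
have [W0 Woo] := dyadic_weight_gt0 DQ.
have [c0 cf] := ancestors_sum_fin DQ.
have := @mean_oscillation_le _ _ R mu Q (b_sparse S w) (b_local Q) (ancestors_sum Q)
  mQ Q0 Qoo cf (@measurable_b_local Q Q) (b_local_ge0 Q) (integral_b_local_fin DQ) c0
  (fun x Qx => b_sparse_local DQ Qx).
move=> osc; apply: (lee_div_of_le_mul W0 Woo); apply: (le_trans osc).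
by rewrite -!muleA lee_wpmul2l// muleA; exact: integral_b_local_le.
Qed.

(** A set of compact image is covered by finitely many unit cubes of the grid, and
    [b_sparse] is a constant plus an integrable function on each. *)
Lemma locally_integrable_b_sparse : locally_integrable_Rn (b_sparse S w).
Proof.
split; first exact: measurable_b_sparse.
move=> K /compact_sub_box[M KM].
pose F := level_cubes D 0 M.
have FD Q : F Q -> D Q by case.
have fF : finite_set F by exact: finite_level_cubes.
have mb : measurable_fun setT (fun x => `|b_sparse S w x|).
  exact: measurableT_comp measurable_b_sparse.
have m1 Q : F Q -> measurable_fun setT (fun x => `|b_sparse S w x| * (\1_Q x)%:E).
  move=> /FD DQ; have [mQ _ _] := dyadic_measure gridD DQ.
  have m1Q : measurable_fun setT (fun x => (\1_Q x : R)%:E).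
    by apply/measurable_EFinP; exact: measurable_indic.
  exact: emeasurable_funM mb m1Q.
have ge0_term Q x : 0 <= `|b_sparse S w x| * (\1_Q x)%:E.
  by rewrite mule_ge0// lee_fin indicE.
apply: (@le_lt_trans _ _
    (\int[mu]_x \esum_(Q in F) (`|b_sparse S w x| * (\1_Q x)%:E))).
  apply: le_ge0_integral_subset => // [x _|x Kx]; first exact: esum_ge0.
  split => //; have [Q FQ Qx] := level_cubes_cover gridD 0 (KM _ Kx).
  apply: esum_ge; exists [set Q]; first by split=> // P ->.
  by rewrite fsbig_set1 indicE mem_set// mule1.
rewrite ge0_integral_esum//; last exact: finite_set_countable.
rewrite esum_fset//; last by move=> Q _; exact: integral_ge0.
rewrite fsbig_finite// big_seq; apply: lte_sum_pinfty => Q.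
rewrite in_fset_set// => /set_mem/FD DQ.
have [mQ Q0 Qoo] := dyadic_measure gridD DQ.
have [c0 cf] := ancestors_sum_fin DQ.
rewrite integral_mul_indic setTI.
rewrite (eq_integral (fun x => ancestors_sum Q + b_local Q x)); last first.
  move=> x /set_mem Qx; rewrite (b_sparse_local DQ Qx) gee0_abs//.
  by rewrite adde_ge0// b_local_ge0.
rewrite ge0_integralD//; last 2 first.
- by move=> x _; exact: b_local_ge0.
- exact: measurable_b_local.
rewrite integral_cst// lte_add_pinfty//; last exact: integral_b_local_fin.
by rewrite lte_mul_pinfty.
Qed.

End sparse.

Theorem mainTheorem2 (R : realType) (n : nat) (D : set (set (Rn R n)))
    (gridD : dyadic_grid D) (p : R) (p_gt1 : (1 < p)%R)
    (w : Rn R n -> R) (w_Ap : Ap_weight D p w)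
    (S : set (set (Rn R n))) (S_sub_D : S `<=` D)
    (Lambda : R) (Lambda_gt1 : (1 < Lambda)%R)
    (S_carleson : carleson D S Lambda)
    (S_chain : ~ infinitely_increasing_chain S) :
  BMO D w (b_sparse S w) /\
  BMO_norm D w (b_sparse S w) <=
    2%:E * Ap_constant D p w * (Lambda `^ p)%:E.
Proof.
have norm_le := BMO_norm_b_sparse gridD p_gt1 w_Ap S_sub_D Lambda_gt1
  S_carleson S_chain.
split; last exact: norm_le; split.
  exact: (locally_integrable_b_sparse gridD p_gt1 w_Ap S_sub_D Lambda_gt1
    S_carleson S_chain).
apply: (le_lt_trans norm_le).
have [Q DQ] := grid_nonempty gridD.
have [Af _] := Ap_constant_fin gridD p_gt1 w_Ap DQ.
have : 2%:E * Ap_constant D p w * (Lambda `^ p)%:E \is a fin_num.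
  by rewrite !fin_numM//.
by rewrite fin_numE => /andP[_]; rewrite ltey.
Qed.
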